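(* Let $K$ be a field and $n\ge 1$ an integer, and suppose that the integer $\mathrm{ELS}(n)-\mathrm{OLS}(n)$ is nonzero when regarded as an element of $K$ (i.e. the characteristic of $K$ does not divide $\mathrm{ELS}(n)-\mathrm{OLS}(n)$). Then $\mathrm{OBC}_n(K)$ holds: there exist functions $f_1,\ldots,f_n$, where $f_i$ assigns a permutation $\pi_i=f_i(B_1,\ldots,B_i)\in S_n$ to every $i$-tuple $(B_1,\ldots,B_i)$ of ordered bases of $K^n$, such that for every sequence $B_1,\ldots,B_n$ of ordered bases of $K^n$, writing $B_i=(v_{i,1},\ldots,v_{i,n})$ and $\pi_i=f_i(B_1,\ldots,B_i)$, for each $j=1,\ldots,n$ the vectors $v_{1,\pi_1(j)},v_{2,\pi_2(j)},\ldots,v_{n,\pi_n(j)}$ form a basis of $K^n$.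
   Context: A Latin square of order $n$ is an $n\times n$ array $a=(a_{ij})$ with entries in $[n]=\{1,\ldots,n\}$ such that each element of $[n]$ occurs exactly once in each row and each column. Then for each fixed $i$ the map $j\mapsto a_{ij}$ and for each fixed $j$ the map $i\mapsto a_{ij}$ are permutations of $[n]$; the sign of $a$ is the product of the signs of these $2n$ permutations. $\mathrm{ELS}(n)$ (resp. $\mathrm{OLS}(n)$) denotes the number of Latin squares of order $n$ with sign $+1$ (resp. $-1$). The condition in the claim says that the permutation $\pi_i$ applied to the $i$-th row is chosen ''online'', i.e. depending only on the first $i$ bases and not on the later ones. *)

(* Defs.v *)
From mathcomp Require Import all_boot all_order all_fingroup all_algebra.

Set Implicit Arguments.
Unset Strict Implicit.
Unset Printing Implicit Defensive.

Import GRing.Theory.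
Local Open Scope ring_scope.

(* Rows, columns and symbols are all indexed by 'I_n = {0, ..., n-1} instead
   of {1, ..., n}. *)
Definition latin (n : nat) (a : 'M['I_n]_n) : bool :=
  [forall i, forall x, #|[set j | a i j == x]| == 1%N] &&
  [forall j, forall x, #|[set i | a i j == x]| == 1%N].

(* The permutation with underlying function f; the default value 1 is only
   taken when f is not injective, so never on a line of a Latin square. *)
Definition fun_perm (n : nat) (f : 'I_n -> 'I_n) : 'S_n :=
  insubd (1%g : 'S_n) (finfun f).

Definition latin_sign (n : nat) (a : 'M['I_n]_n) : int :=
  (\prod_(i < n) (-1) ^+ (fun_perm (fun j => a i j))) *
  (\prod_(j < n) (-1) ^+ (fun_perm (fun i => a i j))).

Definition ELS (n : nat) : nat :=
  #|[set a : 'M['I_n]_n | latin a & latin_sign a == 1]|.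

Definition OLS (n : nat) : nat :=
  #|[set a : 'M['I_n]_n | latin a & latin_sign a == -1]|.

Definition ordered_basis (K : fieldType) (n : nat) : Type :=
  {B : n.-tuple 'rV[K]_n | basis_of fullv B}.

Definition basis_vector (K : fieldType) (n : nat) (B : ordered_basis K n)
  (j : 'I_n) : 'rV[K]_n := tnth (val B) j.

Definition prefix_upto (T : Type) (n : nat) (B : 'I_n -> T) (i : 'I_n) :
  'I_i.+1 -> T := fun k => B (widen_ord (ltn_ord i) k).

(* With 0-based indices, the i-th choice sees the i.+1 bases B_0, ..., B_i. *)
Definition OBC (K : fieldType) (n : nat) : Prop :=
  exists f : forall i : 'I_n, ('I_i.+1 -> ordered_basis K n) -> 'S_n,
  forall (B : 'I_n -> ordered_basis K n) (j : 'I_n),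
    basis_of fullv
      [tuple basis_vector (B i) (f i (prefix_upto B (i := i)) j) | i < n].

(* Main.v *)
(** Write F(U) for the product over j of det(u_{1j}, ..., u_{nj}), where u_{ij} is
    the j-th vector of row i.  For k <= n let c_k(u_1, ..., u_k) be the sum,
    over all permutations p_i (k < i <= n) of the standard basis E, of
    prod_i sgn(p_i) * F(u_1, ..., u_k, E p_{k+1}, ..., E p_n).
    Then c_0 = ELS(n) - OLS(n) and c_n = F.  Antisymmetrizing the form c_{k+1}
    in its last row gives a multiple of the determinant, namely
      sum_p sgn(p) c_{k+1}(u_1, ..., u_k, w p) = det(w) c_k(u_1, ..., u_k).
    So if c_k(u_1, ..., u_k) <> 0 and w is a basis, some reordering of w keeps
    c_{k+1} nonzero; greedily choosing such a reordering only depends on the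
    bases seen so far, and ends with F <> 0. *)

Require Import Defs.
From mathcomp Require Import all_boot all_order all_fingroup all_algebra.

Set Implicit Arguments.
Unset Strict Implicit.
Unset Printing Implicit Defensive.

Import GRing.Theory.
Local Open Scope ring_scope.

Lemma fun_permE (n : nat) (f : 'I_n -> 'I_n) : injective f -> fun_perm f =1 f.
Proof.
move=> f_inj x.
have fP : injectiveb (finfun f).
  by apply/injectiveP=> i j; rewrite !ffunE => /f_inj.
have fK := insubdK (1%g : 'S_n) fP; rewrite /= in fK.
by rewrite /fun_perm -pvalE fK ffunE.
Qed.

Lemma card1_fibers (n : nat) (f : 'I_n -> 'I_n) :
  [forall x, #|[set j | f j == x]| == 1%N] = injectiveb f.
Proof.
apply/forallP/injectiveP => [f1 i j fij | f_inj x].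
  have /cards1P[y fy] := f1 (f j).
  have: i \in [set k | f k == f j] by rewrite inE fij.
  have: j \in [set k | f k == f j] by rewrite inE.
  by rewrite fy !inE => /eqP-> /eqP.
rewrite -(f_invF f_inj x); apply/cards1P; exists (invF f_inj x).
by apply/setP=> i; rewrite !inE (inj_eq f_inj).
Qed.

Lemma latinE (n : nat) (a : 'M['I_n]_n) :
  latin a = [forall i, injectiveb (fun j => a i j)] &&
            [forall j, injectiveb (fun i => a i j)].
Proof.
by congr (_ && _); apply: eq_forallb => i; rewrite -card1_fibers.
Qed.

Lemma latin_sign_pm1 (n : nat) (a : 'M['I_n]_n) :
  latin_sign a = 1 \/ latin_sign a = -1.
Proof.
rewrite /latin_sign -!expr_sum -exprD -signr_odd.
by case: odd; [right | left].
Qed.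

Lemma ELS_sub_OLS (n : nat) :
  (ELS n)%:Z - (OLS n)%:Z = \sum_(a : 'M['I_n]_n | latin a) latin_sign a.
Proof.
rewrite (bigID (fun a => latin_sign a == 1)) /=; congr (_ + _).
  rewrite (eq_bigr (fun=> 1)) => [|a /andP[_ /eqP]//].
  by rewrite sumr_const pmulrn intz /ELS cardsE.
rewrite (eq_bigr (fun=> -1)) => [|a /andP[_]]; last first.
  by case: (latin_sign_pm1 a) => ->.
rewrite sumr_const mulNrn pmulrn intz /OLS cardsE; congr (- (Posz _)).
apply: eq_card => a; rewrite !unfold_in; congr (_ && _).
by case: (latin_sign_pm1 a) => ->.
Qed.

Section AlternatingSums.

Variables (K : fieldType) (n : nat).
Implicit Types (g : 'I_n -> 'I_n) (W : 'M[K]_n) (U : nat -> 'M[K]_n)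
  (s : {ffun 'I_n -> 'S_n}).

(* The sign of g if g is a permutation, and 0 otherwise. *)
Definition fun_sign g : K := \det (\matrix_(j, x) (g j == x)%:R : 'M[K]_n).

Lemma fun_sign_inj g : injective g -> fun_sign g = (-1) ^+ (fun_perm g).
Proof.
move=> g_inj; rewrite -det_perm; congr (\det _).
by apply/matrixP=> i j; rewrite !mxE fun_permE.
Qed.

Lemma fun_sign_ninj g : ~~ injectiveb g -> fun_sign g = 0.
Proof.
case/injectivePn=> i [j nij gij]; apply: (determinant_alternate nij) => x.
by rewrite !mxE gij.
Qed.

(** The left side is the Leibniz expansion of the determinant of the 0/1 matrix of [g] times the
    transpose of [W]: the (j, i) entry of this product is [W i (g j)]. *)
Lemma alternating_prod W g :
  \sum_(p : 'S_n) (-1) ^+ p * \prod_j W (p j) (g j) = \det W * fun_sign g.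
Proof.
rewrite -(det_tr W) mulrC -det_mulmx; apply: eq_bigr => p _; congr (_ * _).
apply: eq_bigr => j _; rewrite mxE (bigD1 (g j)) //= !mxE eqxx mul1r.
by rewrite big1 ?addr0 // => x /negPf; rewrite mxE eq_sym => ->; rewrite mul0r.
Qed.

(* This is c_k(u_1, ..., u_k), with the determinants in F expanded (s j is the
   permutation used for the j-th one) and the sums over the p_i performed. *)
Definition partial_form (k : nat) U : K :=
  \sum_(s : {ffun 'I_n -> 'S_n}) (\prod_j (-1) ^+ (s j)) *
    \prod_(i < n) (if (i < k)%N then \prod_j U i j (s j i)
                   else fun_sign (fun j => s j i)).

(** Read [s] as the array with columns [s j]. Its summand vanishes unless every row is a permutation
    too, that is, unless the array is Latin; the two products are then its column signs and its row
    signs. *)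
Lemma partial_form0 U : partial_form 0 U = ((ELS n)%:Z - (OLS n)%:Z)%:~R.
Proof.
pose array s : 'M['I_n]_n := \matrix_(i, j) s j i.
rewrite ELS_sub_OLS rmorph_sum /=.
rewrite (reindex_onto array (fun a => [ffun j => fun_perm (fun i => a i j)]));
  last first.
  move=> a; rewrite latinE => /andP[_ /forallP a_inj].
  by apply/matrixP=> i j; rewrite !mxE ffunE fun_permE //; apply/injectiveP.
rewrite /partial_form (bigID (fun s => latin (array s))) /=.
have arrayK s j : fun_perm (fun i => array s i j) = s j.
  apply/permP=> i; rewrite fun_permE ?mxE // => i1 i2.
  by rewrite !mxE => /perm_inj.
rewrite [X in _ + X]big1 ?addr0 => [|s].
  apply: eq_big => [s | s].
    suff -> : [ffun j => fun_perm (fun i => array s i j)] = s.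
      by rewrite eqxx andbT.
    by apply/ffunP=> j; rewrite ffunE arrayK.
  rewrite latinE => /andP[/forallP s_inj _].
  rewrite /latin_sign mulrC rmorphM !rmorph_prod; congr (_ * _); last first.
    by apply: eq_bigr => j _; rewrite arrayK rmorphXn rmorphN1.
  apply: eq_bigr => i _; rewrite rmorphXn rmorphN1 -fun_sign_inj.
    by congr (\det _); apply/matrixP=> j x; rewrite !mxE.
  exact/injectiveP.
rewrite latinE negb_and.
suff -> : [forall j, injectiveb (fun i => array s i j)].
  rewrite orbF negb_forall => /existsP[i s_ninj].
  rewrite [X in _ * X](bigD1 i) //= fun_sign_ninj ?mul0r ?mulr0 //.
  apply: contra s_ninj => /injectiveP s_inj; apply/injectiveP=> j1 j2.
  by rewrite !mxE => /s_inj.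
apply/forallP=> j; apply/injectiveP=> i1 i2; rewrite !mxE; exact: perm_inj.
Qed.

Lemma partial_form_full U :
  partial_form n U = \prod_j \det (\matrix_(i < n) row j (U i)).
Proof.
rewrite /determinant bigA_distr_bigA /=; apply: eq_bigr => s _.
rewrite big_split /=; congr (_ * _); rewrite exchange_big /=.
by apply: eq_bigr => i _; rewrite ltn_ord; apply: eq_bigr => j _; rewrite !mxE.
Qed.

Definition set_row U (k : nat) W : nat -> 'M[K]_n :=
  fun i => if i == k then W else U i.

(** For fixed [s], only the factor i = k depends on [p]. By [alternating_prod] its signed sum is
    [\det W] times the factor that [partial_form k U] has at i = k. *)
Lemma alternating_partial_form (k : 'I_n) U W :
  \sum_(p : 'S_n) (-1) ^+ p * partial_form k.+1 (set_row U k (row_perm p W)) =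
  \det W * partial_form k U.
Proof.
rewrite /partial_form mulr_sumr.
under eq_bigr do rewrite mulr_sumr.
rewrite exchange_big /=; apply: eq_bigr => s _.
transitivity (\prod_j (-1) ^+ (s j) * (\det W * fun_sign (fun j => s j k)) *
    \prod_(i < n | i != k) (if (i < k)%N then \prod_j U i j (s j i)
                            else fun_sign (fun j => s j i))); last first.
  by rewrite [X in _ = _ * (_ * X)](bigD1 k) //= ltnn mulrCA !mulrA.
rewrite -alternating_prod mulr_sumr mulr_suml; apply: eq_bigr => p _.
rewrite [X in _ * (_ * X) = _](bigD1 k) //= ltnSn /set_row eqxx.
under [\prod_(_ < n) row_perm _ _ _ _]eq_bigr do rewrite mxE.
rewrite [X in _ * (_ * (_ * X)) = _](eq_bigr (fun i : 'I_n =>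
    if (i < k)%N then \prod_j U i j (s j i) else fun_sign (fun j => s j i))).
  by rewrite mulrCA !mulrA.
by move=> i nik; rewrite ltnS leq_eqVlt -[(i == k :> nat)]/(i == k) (negPf nik).
Qed.

Lemma exists_reordering (k : 'I_n) U W :
  \det W != 0 -> partial_form k U != 0 ->
  exists p : 'S_n, partial_form k.+1 (set_row U k (row_perm p W)) != 0.
Proof.
move=> W_neq0 U_neq0; apply/existsP; apply: contraT => /existsPn p0.
have := mulf_neq0 W_neq0 U_neq0.
rewrite -alternating_partial_form big1 ?eqxx // => p _.
by move/negPn/eqP: (p0 p) => ->; rewrite mulr0.
Qed.

(** The default 1 is taken only when no reordering works, which [exists_reordering] excludes for k <
    n, invertible [W] and nonzero [partial_form k U]. *)
Definition next_perm (k : nat) U W : 'S_n :=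
  odflt 1%g [pick p | partial_form k.+1 (set_row U k (row_perm p W)) != 0].

Fixpoint reordered (B : nat -> 'M[K]_n) (k : nat) : nat -> 'M[K]_n :=
  if k isn't k'.+1 then fun=> 0 else
  let U := reordered B k' in
  set_row U k' (row_perm (next_perm k' U (B k')) (B k')).

(** This is what makes the greedy choice online. *)
Lemma eq_reordered (B B' : nat -> 'M[K]_n) k :
  (forall i, (i < k)%N -> B i = B' i) -> reordered B k = reordered B' k.
Proof.
elim: k => //= k IHk eqB.
by rewrite IHk ?eqB // => i ltik; rewrite eqB // ltnW.
Qed.

Lemma reordered_row (B : nat -> 'M[K]_n) k i : (i < k)%N ->
  reordered B k i = row_perm (next_perm i (reordered B i) (B i)) (B i).
Proof.
elim: k => //= k IHk; rewrite ltnS leq_eqVlt /set_row.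
by case: eqP => [-> | _] //= /IHk.
Qed.

Lemma partial_form_reordered (B : nat -> 'M[K]_n) k :
    (forall i, \det (B i) != 0) -> ((ELS n)%:Z - (OLS n)%:Z)%:~R != 0 :> K ->
  (k <= n)%N -> partial_form k (reordered B k) != 0.
Proof.
move=> B_neq0 EO_neq0; elim: k => [|k IHk] ltkn; first by rewrite partial_form0.
rewrite /= /next_perm; case: pickP => [p //|p0].
have [p] := @exists_reordering (Ordinal ltkn) _ _ (B_neq0 k) (IHk (ltnW ltkn)).
by have /= -> := p0 p.
Qed.

Lemma basis_of_det (v : n.-tuple 'rV[K]_n) :
  basis_of fullv v = (\det (\matrix_j tnth v j) != 0).
Proof.
rewrite basisEfree subvf size_tuple dimvf /dim /= mul1n leqnn !andbT.
rewrite -unitfE -[RHS]/(_ \in unitmx) -row_free_unit.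
apply/freeP/idP => [v_free | v_free c cv0 i].
  apply: inj_row_free => u uv0.
  apply/rowP=> i; rewrite mxE; apply: v_free.
  rewrite -[RHS]uv0 mulmx_sum_row; apply: eq_bigr => j _.
  by rewrite rowK (tnth_nth 0).
suff /rowP/(_ i) : \row_j c j = 0 by rewrite !mxE.
apply: (row_free_inj v_free); rewrite mul0mx mulmx_sum_row -[RHS]cv0.
by apply: eq_bigr => j _; rewrite mxE rowK (tnth_nth 0).
Qed.

End AlternatingSums.

Theorem theorem2p2 (K : fieldType) (n : nat) (hn : (1 <= n)%N)
  (hK : ((ELS n)%:Z - (OLS n)%:Z)%:~R != 0 :> K) : OBC K n.
Proof.
pose mx (b : ordered_basis K n) : 'M[K]_n := \matrix_j basis_vector b j.
have mx_neq0 b : \det (mx b) != 0 by rewrite -basis_of_det (valP b).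
(* A prefix becomes a sequence indexed by all naturals; [inord] sends every m > i to 0. *)
pose ext (i : 'I_n) (B : 'I_i.+1 -> ordered_basis K n) m := mx (B (inord m)).
exists (fun (i : 'I_n) B =>
  next_perm i (reordered (ext i B) i) (ext i B i)) => B j.
(* The whole sequence is extended likewise: indices m >= n fall back to 0, which lies in ['I_n] as n
   >= 1. *)
pose C m := mx (B (insubd (Ordinal hn) m)).
have extC (i : 'I_n) m : (m <= i)%N -> ext i (prefix_upto B (i := i)) m = C m.
  move=> lemi; rewrite /ext /prefix_upto /C; congr (mx (B _)); apply: val_inj.
  by rewrite /= inordK ?ltnS // val_insubd (leq_ltn_trans lemi).
have := partial_form_reordered (fun m => mx_neq0 _) hK (leqnn n) (B := C).
(* A nonzero product of determinants has a nonzero j-th factor. *)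
rewrite partial_form_full => /prodf_neq0/(_ j isT).
rewrite basis_of_det; congr (\det _ != 0); apply/row_matrixP=> i.
rewrite !rowK tnth_mktuple reordered_row // extC //.
rewrite (@eq_reordered _ _ _ C) => [|m /ltnW/extC//].
apply/rowP=> x; rewrite !mxE; congr (basis_vector (B _) _ _ _).
by apply: val_inj; rewrite val_insubd ltn_ord.
Qed.
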